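(* Let $p$ be a prime and let $\alpha,\beta,X,Y$ be indeterminates over $\mathbb F_p$. For a parameter $\gamma$ put \[ \mathcal{E}^{(\gamma)}(X)=\sum_{k=0}^{p-1}\frac{X^k}{(1+\gamma)(2+\gamma)\cdots(k+\gamma)}. \] Then \[ \mathcal{E}^{(\alpha)}(X)\cdot\mathcal{E}^{(\beta)}(Y)\equiv \mathcal{E}^{(\alpha+\beta)}(X+Y)\cdot\biggl(1+\sum_{i=1}^{p-1}\frac{X^iY^{p-i}}{(\alpha+i)_i\,(\beta+p-i)_{p-i}}\biggr) \] in $\mathbb F_p(\alpha,\beta)[X,Y]$, modulo the ideal generated by $X^p-(\alpha^p-\alpha)$ and $Y^p-(\beta^p-\beta)$.
   Context: $(x)_n=x(x-1)\cdots(x-n+1)$ denotes the falling factorial (with $(x)_0=1$); thus $(\alpha+i)_i=(\alpha+i)(\alpha+i-1)\cdots(\alpha+1)$. The polynomial $\mathcal{E}^{(\alpha)}(X)$ lies in $\mathbb F_p(\alpha)[X]$, and $\mathcal{E}^{(\alpha+\beta)}$, $\mathcal{E}^{(\beta)}$ denote the same polynomial with $\gamma$ replaced by $\alpha+\beta$, resp. $\beta$. *)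

(* Defs.v *)
From HB Require Import structures.
From mathcomp Require Import all_boot all_order all_algebra.
From mathcomp Require Import fraction.
From mathcomp Require Import mpoly.

Set Implicit Arguments.
Unset Strict Implicit.
Unset Printing Implicit Defensive.

Import GRing.Theory.
Local Open Scope ring_scope.

Definition falling (R : pzRingType) (x : R) (n : nat) : R :=
  \prod_(j < n) (x - j%:R).

Definition calE (p : nat) (K : fieldType) (gamma : K) : {poly K} :=
  \sum_(k < p) (\prod_(1 <= j < k.+1) (j%:R + gamma))^-1 *: 'X^k.

Definition in_ideal2 (A : comPzRingType) (a b f : A) : Prop :=
  exists u v : A, f = u * a + v * b.

(* F_p(alpha, beta); faithful only for p prime, since 'F_p is the field of
   integers modulo the least prime divisor of p. *)
Definition Kab (p : nat) : fieldType := {fraction {mpoly 'F_p[2]}}.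

Definition alpha (p : nat) : Kab p := tofrac ('X_0 : {mpoly 'F_p[2]}).
Definition beta (p : nat) : Kab p := tofrac ('X_1 : {mpoly 'F_p[2]}).

Definition Xv (p : nat) : {mpoly (Kab p)[2]} := 'X_0.
Definition Yv (p : nat) : {mpoly (Kab p)[2]} := 'X_1.

(* Main.v *)
Require Import Defs.
From HB Require Import structures.
From mathcomp Require Import all_boot all_order all_algebra.
From mathcomp Require Import fraction.
From mathcomp Require Import mpoly.
From mathcomp Require Import ring.

Import GRing.Theory.
Local Open Scope ring_scope.

(** Write e_k = X^k / ((1+a)...(k+a)), f_k for the same term in (b, Y) and g_k
    for the one in (a+b, X+Y). Since (1+a)...(p+a) = a^p - a in characteristic
    p, the sequences e and f are p-periodic modulo the ideal, so the sums
    S_n = sum_(i+j = n mod p) e_i f_j make sense. From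
    X e_k = (a+k+1) e_(k+1) one gets (X+Y) S_n = (a+b+n+1) S_(n+1), which is
    the recurrence satisfied by g; hence S_n = g_n S_0. Summing over n mod p
    gives the theorem, S_0 being the second factor of the right-hand side. *)

(** * Congruences modulo an ideal with two generators *)

Section Ideal.
Context {A : comPzRingType} {P Q : A}.
Implicit Types f g : A.

Lemma in_ideal2_0 : in_ideal2 P Q 0.
Proof. by exists 0, 0; rewrite !mul0r addr0. Qed.

Lemma in_ideal2D f g :
  in_ideal2 P Q f -> in_ideal2 P Q g -> in_ideal2 P Q (f + g).
Proof. by move=> [u [v ->]] [u' [v' ->]]; exists (u + u'), (v + v'); ring. Qed.

Lemma in_ideal2Ml f g : in_ideal2 P Q g -> in_ideal2 P Q (f * g).
Proof. by move=> [u [v ->]]; exists (f * u), (f * v); ring. Qed.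

Lemma in_ideal2N f : in_ideal2 P Q f -> in_ideal2 P Q (- f).
Proof. by rewrite -mulN1r; apply: in_ideal2Ml. Qed.

Lemma in_ideal2_gen1 : in_ideal2 P Q P.
Proof. by exists 1, 0; ring. Qed.

Lemma in_ideal2_gen2 : in_ideal2 P Q Q.
Proof. by exists 0, 1; ring. Qed.

Lemma in_ideal2_sum n (F : nat -> A) :
  (forall i, in_ideal2 P Q (F i)) -> in_ideal2 P Q (\sum_(0 <= i < n) F i).
Proof. by move=> H; apply: big_ind => //; [exact: in_ideal2_0 | exact: in_ideal2D]. Qed.

(** Moving the window of length [p] one step to the right trades [F m] for [F (m + p)], which is
    congruent to it. *)
Lemma in_ideal2_periodic_sum p (F : nat -> A) :
  (forall k, in_ideal2 P Q (F (k + p)%N - F k)) ->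
  forall m, in_ideal2 P Q (\sum_(0 <= n < p) F (n + m)%N - \sum_(0 <= n < p) F n).
Proof.
move=> H; elim=> [|m IH].
  rewrite (eq_bigr F) ?subrr; first exact: in_ideal2_0.
  by move=> i _; rewrite addn0.
have E : \sum_(0 <= n < p) F (n + m)%N + F (m + p)%N =
    F m + \sum_(0 <= n < p) F (n + m.+1)%N.
  transitivity (\sum_(0 <= n < p.+1) F (n + m)%N).
    by rewrite big_nat_recr //= [(m + p)%N]addnC.
  by rewrite big_nat_recl //=; congr (_ + _); apply: eq_bigr => n _; rewrite addSnnS.
rewrite -[\sum_(0 <= n < p) F (n + m.+1)%N](addKr (F m)) -E.
rewrite [X in X - _]addrCA [- F m + _]addrC addrAC.
exact: in_ideal2D.
Qed.
End Ideal.

(** * The denominators and their value at [p] in characteristic [p] *)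

Definition rising {K : fieldType} (a : K) (k : nat) : K :=
  \prod_(1 <= j < k.+1) (j%:R + a).

Section Rising.
Context {K : fieldType}.
Implicit Types a : K.

Lemma risingS a k : rising a k.+1 = rising a k * (k.+1%:R + a).
Proof. by rewrite /rising big_nat_recr. Qed.

Lemma rising0 a : rising a 0 = 1.
Proof. by rewrite /rising big_geq. Qed.

Lemma rising_neq0 a k : (forall j, j%:R + a != 0) -> rising a k != 0.
Proof.
by move=> H; elim: k => [|k IH]; rewrite ?rising0 ?oner_eq0 // risingS mulf_neq0.
Qed.

Lemma falling_rising a k : falling (a + k%:R) k = rising a k.
Proof.
rewrite /rising big_add1 big_nat_rev big_mkord /falling; apply: eq_bigr => i _ /=.
by rewrite add0n subnSK // natrB 1?ltnW //; ring.
Qed.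

Lemma natr_inj_below_pchar p (i j : nat) : p \in [pchar K] ->
  (i < p)%N -> (j < p)%N -> i%:R = j%:R :> K -> i = j.
Proof.
move=> pK; wlog le_ij : i j / (i <= j)%N => [W|] ip jp E.
  by have /orP[/W|/W Wji] := leq_total i j; [exact | apply/esym/Wji].
have : (p %| j - i)%N by rewrite (dvdn_pcharf pK) natrB // E subrr.
rewrite /dvdn modn_small; last by apply: leq_ltn_trans jp; exact: leq_subr.
by rewrite subn_eq0 => le_ji; apply/eqP; rewrite eqn_leq le_ij.
Qed.

(** By Fermat, the [p] distinct elements [j%:R] with [j < p] are roots of the monic polynomial
    ['X^p - 'X], which therefore splits as the product of the ['X - j]; evaluate at [a]. *)
Lemma rising_pchar a p : p \in [pchar K] -> rising a p = a ^+ p - a.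
Proof.
move=> pK; have p_gt1 := prime_gt1 (pcharf_prime pK).
pose rs : seq K := [seq j%:R | j <- iota 0 p].
have szP : size ('X^p - 'X : {poly K}) = p.+1.
  by rewrite size_polyDl size_polyXn // size_polyN size_polyX.
have rsP : all (root ('X^p - 'X : {poly K})) rs.
  apply/allP=> _ /mapP[j _ ->]; rewrite rootE !hornerE.
  by rewrite -(pFrobenius_autE pK) pFrobenius_aut_nat subrr.
have rsU : uniq_roots rs.
  rewrite uniq_rootsE map_inj_in_uniq ?iota_uniq // => i j.
  by rewrite !mem_iota => ip jp; exact: (@natr_inj_below_pchar p).
have := all_roots_prod_XsubC _ rsP rsU.
rewrite szP size_map size_iota => /(_ erefl).
have -> : lead_coef ('X^p - 'X : {poly K}) = 1.
  by rewrite lead_coefDl ?lead_coefXn // size_polyXn size_polyN size_polyX.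
rewrite scale1r big_map => /(congr1 (horner^~ a)).
rewrite !hornerE horner_prod => ->.
(* Reversing the product pairs the root [i] with the factor [(p - i) + a], which is [a - i] because
   [p] vanishes in [K]. *)
rewrite /rising big_add1 big_nat_rev /=  /index_iota subn0 big_seq [RHS]big_seq.
apply: eq_bigr => i; rewrite mem_iota add0n => /andP[_ ip].
by rewrite hornerXsubC subnSK // natrB 1?ltnW // (pcharf0 pK); ring.
Qed.
End Rising.

(** * The terms of the truncated exponentials and their cyclic convolution *)

Definition expterm {K : fieldType} {A : comAlgType K} (a : K) (x : A) (k : nat) : A :=
  (rising a k)^-1 *: x ^+ k.

Lemma horner_calE {K : fieldType} {A : comAlgType K} p (a : K) (x : A) :
  horner_alg x (calE p a) = \sum_(0 <= k < p) expterm a x k.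
Proof.
rewrite /calE rmorph_sum /= big_mkord; apply: eq_bigr => k _.
by rewrite linearZ /= rmorphXn /= horner_algX mulr_algl.
Qed.

Section Convolution.
Context {K : fieldType} {A : comAlgType K} {P Q : A}.
Implicit Types (a b : K) (x y : A).

Lemma expterm0 a x : expterm a x 0 = 1.
Proof. by rewrite /expterm rising0 invr1 scale1r. Qed.

Lemma mul_expterm a x k : k.+1%:R + a != 0 ->
  x * expterm a x k = (k.+1%:R + a) *: expterm a x k.+1.
Proof.
move=> nz; rewrite /expterm risingS invfM scalerA mulrCA divff // mulr1.
by rewrite -scalerAr exprS.
Qed.

(** Raising the index by [p] multiplies the denominator by [a ^+ p - a] and the numerator by
    [x ^+ p], and these two agree modulo the ideal. *)
Lemma expterm_periodic p a x : p \in [pchar K] -> (forall j, j%:R + a != 0) ->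
  in_ideal2 P Q (x ^+ p - (a ^+ p - a)%:A) ->
  forall k, in_ideal2 P Q (expterm a x (k + p)%N - expterm a x k).
Proof.
move=> pK nz Hx k.
have E : rising a (k + p)%N = rising a k * (a ^+ p - a).
  elim: k => [|k IH]; first by rewrite rising0 mul1r (rising_pchar _ _ pK).
  by rewrite addSn !risingS IH -addSn natrD (pcharf0 pK) addr0 mulrAC.
have nzp : a ^+ p - a != 0 by rewrite -(rising_pchar _ _ pK) rising_neq0.
have -> : expterm a x (k + p)%N - expterm a x k =
    ((rising a (k + p)%N)^-1 *: x ^+ k) * (x ^+ p - (a ^+ p - a)%:A).
  rewrite /expterm mulrBr -!scalerAl -exprD -scalerAr mulr1 scalerA E invfM.
  by rewrite -mulrA mulVf // mulr1.
exact: in_ideal2Ml.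
Qed.

(* The index [n + p - i] represents [n - i] modulo [p]. *)
Definition cyclic_conv p a x b y (n : nat) : A :=
  \sum_(0 <= i < p) expterm a x i * expterm b y (n + (p - i))%N.

Section Pchar.
Variables (p : nat) (a b : K) (x y : A).
Hypothesis pK : p \in [pchar K].
Hypothesis nz_a : forall j, j%:R + a != 0.
Hypothesis nz_b : forall j, j%:R + b != 0.
Hypothesis nz_ab : forall j, j%:R + (a + b) != 0.
Hypothesis Hx : in_ideal2 P Q (x ^+ p - (a ^+ p - a)%:A).
Hypothesis Hy : in_ideal2 P Q (y ^+ p - (b ^+ p - b)%:A).
Let S := cyclic_conv p a x b y.
Let e := expterm a x.
Let f := expterm b y.

(** With [T] as below, [x] turns the [i]-th summand of [S n] into [T i.+1], while [y] yields
    [n.+1 - i + b] times the [i]-th summand of [S n.+1]. Subtracting [n.+1 + a + b] times that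
    summand leaves [- T i], so the sum telescopes. *)
Lemma mul_cyclic_conv n :
  in_ideal2 P Q ((x + y) * S n - (n.+1%:R + (a + b)) *: S n.+1).
Proof.
pose T i := (i%:R + a) *: (e i * f (n.+1 + p - i)%N).
have tele : \sum_(0 <= i < p) T i.+1 - \sum_(0 <= i < p) T i = T p - T 0%N.
  by rewrite -sumrB telescope_sumr.
have -> : (x + y) * S n - (n.+1%:R + (a + b)) *: S n.+1 = T p - T 0%N.
  rewrite -tele /S /cyclic_conv mulr_sumr scaler_sumr -!sumrB.
  rewrite big_seq [RHS]big_seq; apply: eq_bigr => i.
  rewrite mem_index_iota => /andP[_ ip].
  rewrite mulrDl mulrA mul_expterm // -scalerAl [y * _]mulrCA mul_expterm //.
  rewrite /T -/e -/f subSS.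
  rewrite -[(n.+1 + p - i)%N]addnBA 1?ltnW // -[(n + p - i)%N]addnBA 1?ltnW // -addSn.
  have -> : (n.+1 + (p - i))%:R = n.+1%:R - i%:R :> K.
    by rewrite natrD natrB 1?ltnW // (pcharf0 pK) sub0r.
  rewrite -[e i * (_ *: f _)]scalerAr.
  set u := e i * f (n.+1 + (p - i))%N.
  rewrite -addrA -scalerBl -scaleNr; congr (_ + _ *: u); ring.
(* As [p] is zero in [K], both boundary terms have coefficient [a]; their difference is then
   controlled by the periodicity of [e] and [f]. *)
rewrite /T (pcharf0 pK) !add0r subn0 addnK -scalerBr -mulr_algl.
apply: in_ideal2Ml.
have -> : e p * f n.+1 - e 0%N * f (n.+1 + p)%N =
  f n.+1 * (e (0 + p)%N - e 0%N) + (- e 0%N) * (f (n.+1 + p)%N - f n.+1).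
  by rewrite add0n; ring.
by apply: in_ideal2D; apply: in_ideal2Ml; apply: expterm_periodic.
Qed.

(** The terms for [(a + b, x + y)] satisfy exactly the recurrence that [S] satisfies modulo the
    ideal, and its coefficient [n.+1 + a + b] is invertible. *)
Lemma cyclic_conv_expterm n :
  in_ideal2 P Q (S n - expterm (a + b) (x + y) n * S 0%N).
Proof.
elim: n => [|n IH]; first by rewrite expterm0 mul1r subrr; exact: in_ideal2_0.
set c := n.+1%:R + (a + b); set g := expterm _ _.
have nzc : c != 0 by exact: nz_ab.
have -> : S n.+1 - g n.+1 * S 0%N =
  c^-1%:A * ((x + y) * (S n - g n * S 0%N) + - ((x + y) * S n - c *: S n.+1)).
  have -> : (x + y) * (S n - g n * S 0%N) = (x + y) * S n - c *: g n.+1 * S 0%N.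
    by rewrite mulrBr mulrA mul_expterm.
  rewrite opprB [in RHS]addrC subrKA mulr_algl -[_ *: g _ * _]scalerAl scalerBr !scalerA mulVf //.
  by rewrite !scale1r.
apply: in_ideal2Ml; apply: in_ideal2D; first exact: in_ideal2Ml.
exact/in_ideal2N/mul_cyclic_conv.
Qed.

Lemma calE_mul_in_ideal2 :
  in_ideal2 P Q
    (horner_alg x (calE p a) * horner_alg y (calE p b)
     - horner_alg (x + y) (calE p (a + b))
       * (1 + \sum_(1 <= i < p)
                (falling (a + i%:R) i * falling (b + (p - i)%:R) (p - i))^-1
                  *: (x ^+ i * y ^+ (p - i)))).
Proof.
have p_gt0 := prime_gt0 (pcharf_prime pK).
rewrite !horner_calE; set g := expterm (a + b) (x + y).
set B := 1 + _.
(* Only the terms at [i = 0] differ: [S 0] has [e 0 * f p] where [B] has [1], which is [f 0]. *)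
have S0 : S 0%N - B = f (0 + p)%N - f 0%N.
  rewrite /S /cyclic_conv /B big_ltn // expterm0 mul1r subn0.
  rewrite /f expterm0 opprD addrACA -[RHS]addr0; congr (_ + _).
  apply/eqP; rewrite subr_eq0; apply/eqP/eq_bigr => i _.
  by rewrite !falling_rising add0n /expterm -scalerAl -scalerAr scalerA invfM.
set G := \sum_(0 <= n < p) g n.
set F := \sum_(0 <= n < p) f n.
(* For fixed [i] the indices [n + (p - i)] run over a full period, so each inner difference lies in
   the ideal. *)
have SF : \sum_(0 <= i < p) e i * (\sum_(0 <= n < p) f (n + (p - i))%N - F) =
    \sum_(0 <= n < p) S n - (\sum_(0 <= k < p) e k) * F.
  under eq_bigr => i _ do rewrite mulrBr.
  rewrite sumrB -mulr_suml exchange_big; congr (_ - _).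
  by apply: eq_bigr => i _; rewrite mulr_sumr.
have SG : \sum_(0 <= n < p) (S n - g n * S 0%N) =
    \sum_(0 <= n < p) S n - G * S 0%N.
  by rewrite sumrB -mulr_suml.
(* The three summands pass from the product of the two sums to the sum of the [S n], from there to
   [G * S 0], and finally to [G * B]. *)
have -> : (\sum_(0 <= k < p) e k) * F - G * B =
  - \sum_(0 <= i < p) e i * (\sum_(0 <= n < p) f (n + (p - i))%N - F)
  + \sum_(0 <= n < p) (S n - g n * S 0%N) + G * (f (0 + p)%N - f 0%N).
  by rewrite SF SG -S0; ring.
apply: in_ideal2D; last exact/in_ideal2Ml/expterm_periodic.
apply: in_ideal2D.
  apply/in_ideal2N/in_ideal2_sum => i.
  exact/in_ideal2Ml/in_ideal2_periodic_sum/expterm_periodic.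
by apply: in_ideal2_sum => n; exact: cyclic_conv_expterm.
Qed.
End Pchar.
End Convolution.

(** * Specialisation to the field of rational functions in two parameters *)

Lemma pchar_Kab p : prime p -> p \in [pchar (Kab p)].
Proof.
move=> p_prime; apply: (rmorph_pchar (@tofrac {mpoly 'F_p[2]})).
apply: (rmorph_pchar (@mpolyC 2 'F_p)); exact: pchar_Fp.
Qed.

(** Adding the constant [j] leaves the coefficient at the nontrivial monomial [m] unchanged, so the
    polynomial stays nonzero. *)
Lemma tofrac_neq0_mcoeff p (q : {mpoly 'F_p[2]}) m (j : nat) :
  m != 0%MM -> q@_m != 0 -> j%:R + tofrac q != 0 :> Kab p.
Proof.
move=> nzm nzq; rewrite -(rmorph_nat (@tofrac _)) -rmorphD tofrac_eq0.
apply: contraNneq nzq => /(congr1 (mcoeff m)).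
rewrite mcoeffD -mpolyC_nat mcoeffC (negPf nzm) mulr0 add0r mcoeff0.
by move->.
Qed.

Theorem theorem2 (p : nat) (p_prime : prime p) :
  let a := alpha p in let b := beta p in
  let X := Xv p in let Y := Yv p in
  in_ideal2 (X ^+ p - (a ^+ p - a)%:MP) (Y ^+ p - (b ^+ p - b)%:MP)
    (horner_alg X (calE p a) * horner_alg Y (calE p b)
     - horner_alg (X + Y) (calE p (a + b))
       * (1 + \sum_(1 <= i < p)
                (falling (a + i%:R) i * falling (b + (p - i)%:R) (p - i))^-1
                  *: (X ^+ i * Y ^+ (p - i)))).
Proof.
move=> a b X Y.
have nzU (i : 'I_2) : (U_(i))%MM != 0%MM by rewrite mnm1_eq0.
apply: calE_mul_in_ideal2; first exact: pchar_Kab.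
- move=> j; apply: (tofrac_neq0_mcoeff p 'X_0 _ j (nzU 0)).
  by rewrite mcoeffX eqxx oner_eq0.
- move=> j; apply: (tofrac_neq0_mcoeff p 'X_1 _ j (nzU 1)).
  by rewrite mcoeffX eqxx oner_eq0.
- move=> j; rewrite /a /b /alpha /beta -rmorphD.
  apply: (tofrac_neq0_mcoeff p ('X_0 + 'X_1) _ j (nzU 0)).
  by rewrite mcoeffD !mcoeffX eqxx eq_mnm1 addr0 oner_eq0.
(* The scalar [c%:A] is [c *: 1], which is the constant polynomial [c%:MP] of the generator. *)
- by rewrite -mul_mpolyC mulr1; exact: in_ideal2_gen1.
- by rewrite -mul_mpolyC mulr1; exact: in_ideal2_gen2.
Qed.
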